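(* Let $(\Omega,\mu)$ be a measure space, $\mathcal{X}$ a set, and $k:\mathcal{X}\times\Omega\to\mathbb{C}$ a function such that $\omega\mapsto k(x,\omega)$ is in $L_2(\Omega,\mu)$ for every $x\in\mathcal{X}$. Let $S$ be the integral transform $(Sa)(x)=\int_\Omega a(\omega)k(x,\omega)\,d\mu(\omega)$, $a\in L_2(\Omega,\mu)$, $x\in\mathcal{X}$, let $\mathcal{N}(S)$ be its null space, and let $\mathcal{H}=S(L_2(\Omega,\mu))$ be the reproducing kernel Hilbert space over $\mathcal{X}$ with kernel $K(x,y)=\int_\Omega k(x,\omega)\overline{k(y,\omega)}\,d\mu(\omega)$ and norm $\|\cdot\|$. Let $x_1,\dots,x_N\in\mathcal{X}$, let $\lambda:[0,\infty)\to\mathbb{R}$ be a non-decreasing function and let $L:\mathbb{C}^N\to\mathbb{R}\cup\{\infty\}$ be an arbitrary loss function. Define $\bar J:L_2(\Omega,\mu)\to\mathbb{R}\cup\{\infty\}$ and $J:\mathcal{H}\to\mathbb{R}\cup\{\infty\}$ by $$\bar J(a)=L\bigl((Sa)(x_1),\dots,(Sa)(x_N)\bigr)+\lambda\bigl(\|a\|_{L_2(\Omega,\mu)}\bigr),\qquad J(f)=L\bigl(f(x_1),\dots,f(x_N)\bigr)+\lambda(\|f\|).$$ Then: 1. The functional $\bar J$ possesses a minimiser $a^*$ admitting the representation $$a^*(\omega)=\sum_{i=1}^N\alpha_i\,\overline{k(x_i,\omega)}\qquad\text{with }\alpha_1,\dots,\alpha_N\in\mathbb{C}.$$ 2. For any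 minimiser $a^*$ of $\bar J$, $S(a^* )$ minimises $J$; and for any minimiser $f\in\mathcal{H}$ of $J$, the unique pre-image $a^*\in\mathcal{N}(S)^\bot$ with $S(a^* )=f$ minimises $\bar J$. 3. If $\lambda$ is strictly increasing, then any minimiser $a^*$ of $\bar J$ is of the form given in 1; in fact, then $a^*\in\mathcal{N}(S)^\bot$.
   Context: A reproducing kernel Hilbert space over $\mathcal{X}$ with reproducing kernel $K$ is a Hilbert space $\mathcal{H}$ of functions $\mathcal{X}\to\mathbb{C}$ with $K(\cdot,y)\in\mathcal{H}$ and $f(y)=\langle f,K(\cdot,y)\rangle$ for all $f\in\mathcal{H}$, $y\in\mathcal{X}$ (scalar products are linear in the first argument). The norm of $\mathcal{H}$ is $\|f\|=\inf\{\|a\|_{L_2(\Omega,\mu)} : Sa=f\}$; equivalently, $S$ restricts to an isometric isomorphism of $\mathcal{N}(S)^\bot$ onto $\mathcal{H}$. The null space $\mathcal{N}(S)$ is closed, and the orthogonal complement is taken in $L_2(\Omega,\mu)$.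
   Formalization: Part 1 is stated under the hypothesis that J-bar has some minimiser (for arbitrary L, e.g. L(z)=Re z with λ=0, none need exist); part 3 additionally assumes that J-bar is finite somewhere (if J-bar is identically ∞, every a is a minimiser). *)

(* Defs.v *)
From mathcomp Require Import all_boot all_order all_algebra.
From mathcomp Require Import all_classical all_reals all_analysis.
From mathcomp Require Import complex.

Set Implicit Arguments.
Unset Strict Implicit.
Unset Printing Implicit Defensive.

Import Order.TTheory GRing.Theory Num.Theory.

Local Open Scope classical_set_scope.
Local Open Scope ring_scope.
Local Open Scope complex_scope.

Section ComplexL2.
Context {d : measure_display} {T : measurableType d} {R : realType}.
Context (mu : {measure set T -> \bar R}).

Definition cintegral (f : T -> R[i]) : R[i] :=
  (\int[mu]_w complex.Re (f w)) +i* (\int[mu]_w complex.Im (f w)).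

(* The elements of L2 are represented by functions; two of them are the same
   element when they are equal mu-almost everywhere. *)
Definition L2 : set (T -> R[i]) :=
  [set a | (fun w => complex.Re (a w)) \in Lfun mu 2%:E /\
           (fun w => complex.Im (a w)) \in Lfun mu 2%:E].

Definition L2norm (a : T -> R[i]) : R :=
  fine ('N[mu]_(2%:E) [EFin \o (@ComplexField.Normc.normc R \o a)])%E.

Definition L2dot (a b : T -> R[i]) : R[i] :=
  cintegral (fun w => a w * (b w)^*).

Definition L2orth (A : set (T -> R[i])) : set (T -> R[i]) :=
  [set a | L2 a /\ forall b, A b -> L2dot a b = 0].

End ComplexL2.

Section IntegralTransform.
Context {d : measure_display} {T : measurableType d} {R : realType}.
Context (mu : {measure set T -> \bar R}) {X : Type} (k : X -> T -> R[i]).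

Definition transform (a : T -> R[i]) : X -> R[i] :=
  fun x => cintegral mu (fun w => a w * k x w).

Definition null_space : set (T -> R[i]) :=
  [set a | L2 mu a /\ transform a = (fun=> 0)].

(* With the quotient norm rkhs_norm below, this is the reproducing kernel Hilbert
   space of K x y = cintegral mu (fun w => k x w * (k y w)^* ). *)
Definition rkhs : set (X -> R[i]) := transform @` L2 mu.

Definition rkhs_norm (f : X -> R[i]) : R :=
  inf [set L2norm mu a | a in [set a | L2 mu a /\ transform a = f]].

End IntegralTransform.

Section Functionals.
Context {d : measure_display} {T : measurableType d} {R : realType}.
Context (mu : {measure set T -> \bar R}) {X : Type} (k : X -> T -> R[i]).
Context {N : nat} (x : 'I_N -> X) (L : 'rV[R[i]]_N -> \bar R) (lam : R -> R).

Definition Jbar (a : T -> R[i]) : \bar R :=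
  (L (\row_i transform mu k a (x i)) + (lam (L2norm mu a))%:E)%E.

Definition J (f : X -> R[i]) : \bar R :=
  (L (\row_i f (x i)) + (lam (rkhs_norm mu k f))%:E)%E.

Definition representable (a : T -> R[i]) : Prop :=
  exists alpha : 'I_N -> R[i],
    {ae mu, forall w, a w = \sum_(i < N) alpha i * (k (x i) w)^*}.

End Functionals.

(* The value F v may be +oo, so every point minimises F when F is +oo on A. *)
Definition minimiser {V : Type} {R : realType} (A : set V) (F : V -> \bar R)
    (v : V) : Prop :=
  A v /\ forall u, A u -> (F v <= F u)%E.

(* Main.v *)
Require Import Defs.
From mathcomp Require Import all_boot all_order all_algebra.
From mathcomp Require Import all_classical all_reals all_analysis.
From mathcomp Require Import complex.
From mathcomp Require Import measurable_realfun ring lra.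

Set Implicit Arguments.
Unset Strict Implicit.
Unset Printing Implicit Defensive.

Import Order.TTheory GRing.Theory Num.Theory.
Import numFieldNormedType.Exports.

Local Open Scope classical_set_scope.
Local Open Scope ring_scope.

(** Both functionals see a function only through its values at the sample points
    and through its norm, and the transform [S a] at [y] is the scalar product
    of [a] with the conjugate of [k y]. Let [b] be the orthogonal projection of [a] on the span
    of the conjugates of the [k (x i)]. The residual [a - b] is orthogonal to that
    span, so [S b] and [S a] agree at every [x i], while
    [|a|^2 = |a - b|^2 + |b|^2]. Passing from [a] to [b] thus leaves the loss
    unchanged and does not increase the norm ([span_projection]). As [lam] is
    non-decreasing, the projection of a minimiser is a minimiser, which gives the
    first part. If [lam] is strictly increasing and the minimum is finite, a
    minimiser has the same norm as its projection, so the two are equal almost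
    everywhere; and the span is orthogonal to the null space of [S], because
    every element of that null space is orthogonal to each conjugate of [k y].

    For the second part, each [f] in the range of [S] has a preimage [a]
    orthogonal to the null space ([orth_preimage]). Any other preimage differs
    from [a] by an element of the null space, so by Pythagoras [a] has the least
    norm among them: [|a|] is the quotient norm of [f], and the two functionals
    agree on [a] and [f]. For an arbitrary [a] the value of [J] at [S a] is at
    most that of [Jbar] at [a], and minimisers correspond.

    The span is finite-dimensional, so its projection comes from the Gram-Schmidt
    process ([span_residual]). The null space of [S] may have infinite dimension,
    and projecting on it requires completeness of L2. This is the Riesz-Fischer argument
    ([Lfun2_fast_complete]): the limit is taken pointwise and Fatou's lemma
    bounds the distance to it. The Hilbert space part is carried out for an
    abstract positive semidefinite Hermitian form, since functions that vanish
    almost everywhere have norm [0] without being [0]. *)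

(** * Projections for a positive semidefinite Hermitian form *)

Definition subspace (K : pzRingType) (V : lmodType K) (H : set V) : Prop :=
  H 0 /\ forall c u v, H u -> H v -> H (c *: u + v).

Section Subspace.
Variables (K : pzRingType) (V : lmodType K) (H : set V).
Hypothesis sH : subspace H.

Lemma subspaceZ c u : H u -> H (c *: u).
Proof. by move=> Hu; rewrite -[_ *: _]addr0; apply: sH.2 => //; exact: sH.1. Qed.

Lemma subspaceD u v : H u -> H v -> H (u + v).
Proof. by move=> Hu Hv; rewrite -[u]scale1r; exact: sH.2. Qed.

Lemma subspaceB u v : H u -> H v -> H (u - v).
Proof. by move=> Hu Hv; rewrite addrC -scaleN1r; exact: sH.2. Qed.

Lemma subspace_sum n (c : 'I_n -> K) (e : 'I_n -> V) :
  (forall i, H (e i)) -> H (\sum_(i < n) c i *: e i).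
Proof.
move=> He; elim/big_ind: _ => [|u v Hu Hv|i _]; first exact: sH.1.
- exact: subspaceD.
- exact: subspaceZ.
Qed.

End Subspace.

Lemma cvg_geometric4 (R : realType) (C : R) :
  C * 4^-1 ^+ n @[n --> \oo] --> 0.
Proof. by apply: cvg_geometric; rewrite ger0_norm; lra. Qed.

Lemma le0_cvg (R : realType) (x C : R) (y : R^nat) :
  y n @[n --> \oo] --> 0 -> (forall n, x <= C * y n) -> x <= 0.
Proof.
move=> y0 xy; have cvg0 : C * y n @[n --> \oo] --> 0.
  by rewrite -[X in _ --> X](mulr0 C); apply: cvgM => //; exact: cvg_cst.
rewrite -(cvg_lim _ cvg0) //; apply: limr_ge; first by apply/cvg_ex; exists 0.
exact: nearW.
Qed.

Section SemiInnerProduct.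
Variables (R : realType) (V : lmodType R[i]).
Implicit Types (H : set V) (dot : V -> V -> R[i]).

(** Scalar products are required to behave on a subspace [H] only: the integral
    that defines the scalar product of L2 is not linear on all functions. *)
Record semi_inner_product H dot : Prop := SemiInnerProduct {
  sip_subspace : subspace H ;
  sip_linear : forall c u v w, H u -> H v -> H w ->
    dot (c *: u + v) w = c * dot u w + dot v w ;
  sip_conj : forall u v, H u -> H v -> dot u v = conjc (dot v u) ;
  sip_ge0 : forall u, H u -> 0 <= complex.Re (dot u u) }.

Definition sqnorm dot u : R := complex.Re (dot u u).

Definition sqmod (z : R[i]) : R := complex.Re z ^+ 2 + complex.Im z ^+ 2.

Lemma sqmod_ge0 z : 0 <= sqmod z.
Proof. by rewrite addr_ge0 ?sqr_ge0. Qed.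

Lemma sqmod_eq0 z : sqmod z <= 0 -> z = 0.
Proof.
case: z => a b; rewrite /sqmod /= => h.
have ha : a ^+ 2 = 0 by have := sqr_ge0 a; have := sqr_ge0 b; lra.
have hb : b ^+ 2 = 0 by have := sqr_ge0 a; have := sqr_ge0 b; lra.
by move/eqP: ha; move/eqP: hb; rewrite !sqrf_eq0 => /eqP -> /eqP ->.
Qed.

Lemma sqmodD_le (z w : R[i]) : sqmod (z + w) <= 2 * sqmod z + 2 * sqmod w.
Proof.
case: z w => [a b] [c d]; rewrite /sqmod /=.
by have := sqr_ge0 (a - c); have := sqr_ge0 (b - d); nra.
Qed.

(** Completeness for sequences with a geometric modulus of convergence, which is
    all that a minimising sequence requires: its precision can be prescribed. *)
Definition fast_complete H dot := forall u : nat -> V,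
  (forall n, H (u n)) ->
  (forall n p, (n <= p)%N -> sqnorm dot (u p - u n) <= 4^-1 ^+ n) ->
  exists2 v, H v & sqnorm dot (u n - v) @[n --> \oo] --> 0.

Section Theory.
Variables (H : set V) (dot : V -> V -> R[i]).
Hypothesis hd : semi_inner_product H dot.
Let sH := sip_subspace hd.
Local Notation sqn := (sqnorm dot).

Lemma sqnorm_ge0 u : H u -> 0 <= sqn u.
Proof. exact: sip_ge0. Qed.

Lemma dotDl u v w : H u -> H v -> H w -> dot (u + v) w = dot u w + dot v w.
Proof. by move=> *; rewrite -[u in LHS]scale1r (sip_linear hd) ?mul1r. Qed.

Lemma dotBl u v w : H u -> H v -> H w -> dot (u - v) w = dot u w - dot v w.
Proof.
by move=> *; rewrite addrC -scaleN1r (sip_linear hd) ?mulN1r 1?addrC.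
Qed.

Lemma dot0l v : H v -> dot 0 v = 0.
Proof. by move=> Hv; rewrite -[0 in LHS](subrr v) dotBl ?subrr. Qed.

Lemma dotZl c u v : H u -> H v -> dot (c *: u) v = c * dot u v.
Proof.
move=> Hu Hv; rewrite -[_ *: _]addr0 (sip_linear hd) ?dot0l ?addr0 //.
exact: sH.1.
Qed.

Lemma dot_sum n (c : 'I_n -> R[i]) (e : 'I_n -> V) v :
  (forall i, H (e i)) -> H v ->
  dot (\sum_(i < n) c i *: e i) v = \sum_(i < n) c i * dot (e i) v.
Proof.
move=> He Hv; elim: n c e He => [|n IHn] c e He.
  by rewrite !big_ord0 dot0l.
rewrite !big_ord_recr /= dotDl ?IHn ?dotZl //.
- exact: subspace_sum.
- exact: subspaceZ.
Qed.

Lemma orthC u v : H u -> H v -> dot u v = 0 -> dot v u = 0.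
Proof. by move=> Hu Hv uv; rewrite (sip_conj hd) // uv /= oppr0. Qed.

Lemma sqnorm_linear c u v : H u -> H v ->
  sqn (c *: u + v) =
  sqmod c * sqn u + 2 * complex.Re (c * dot u v) + sqn v.
Proof.
move=> Hu Hv; have Huv : H (c *: u + v) by exact: sH.2.
rewrite /sqnorm (sip_linear hd) //.
rewrite [dot u _](sip_conj hd) // [dot v (_ + _)](sip_conj hd) //.
rewrite !(sip_linear hd) // [dot v u](sip_conj hd) //.
have /(f_equal (@complex.Im R)) := sip_conj hd Hu Hu.
case: (dot u u) => nu iu; case: (dot v v) => nv iv; case: (dot u v) => p q.
by case: c {Huv} => a b; rewrite /sqmod /= => h; nra.
Qed.

Lemma sqnormZ c u : H u -> sqn (c *: u) = sqmod c * sqn u.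
Proof.
move=> Hu; have H0 : H 0 by exact: sH.1.
rewrite -[c *: u]addr0 sqnorm_linear //.
by rewrite {2}/sqnorm (orthC H0 Hu (dot0l Hu)) dot0l // mulr0 /= mulr0 !addr0.
Qed.

Lemma sqnormD_orth u v : H u -> H v -> dot u v = 0 ->
  sqn (u + v) = sqn u + sqn v.
Proof.
move=> Hu Hv uv; rewrite -{1}[u]scale1r sqnorm_linear // uv mulr0 /= mulr0 addr0.
by rewrite /sqmod /= expr1n expr0n addr0 mul1r.
Qed.

(** The derivative test for a minimum, made quantitative. Moving [r] along [z] by
    [- t * dot r z], with [t] real, changes its squared norm by
    [- 2 t D + t^2 D |z|^2], where [D] is the squared modulus of [dot r z]. This
    is at least [- e] for every [t]; [t = 1 / |z|^2] gives the bound. The case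
    [e = |r|^2] is the Cauchy-Schwarz inequality, and small [e] shows that near
    minimisers are nearly orthogonal to the directions of the minimisation. *)
Lemma almost_orthogonal r z e : H r -> H z ->
  (forall c, sqn r - e <= sqn (c *: z + r)) ->
  sqmod (dot r z) <= e * sqn z.
Proof.
move=> Hr Hz min_r; set D := sqmod _.
have tD (t : R) : 2 * t * D <= e + t ^+ 2 * D * sqn z.
  have := min_r (- (t%:C%C * dot r z)); rewrite sqnorm_linear //.
  rewrite [dot z r](sip_conj hd) // /D.
  by case: (dot r z) => a b; rewrite /sqmod /=; set n := sqn z; nra.
have D0 : 0 <= D by exact: sqmod_ge0.
have := sqnorm_ge0 Hz; rewrite le_eqVlt => /orP[/eqP z0|z_gt0].
  (* Along a null vector the change is linear in [t], so [t] may be taken large. *)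
  rewrite -z0 mulr0; have [//|Dgt0] := leP D 0.
  have := tD ((e + 1) / (2 * D)); rewrite -z0 mulr0 addr0.
  have -> : 2 * ((e + 1) / (2 * D)) * D = e + 1 by field; rewrite gt_eqF.
  by move=> ?; lra.
have := tD (sqn z)^-1.
have -> : e + (sqn z)^-1 ^+ 2 * D * sqn z = e + (sqn z)^-1 * D.
  by field; rewrite gt_eqF.
by move=> h; rewrite -ler_pdivrMr // mulrC; lra.
Qed.

Lemma Cauchy_Schwarz u v : H u -> H v -> sqmod (dot u v) <= sqn u * sqn v.
Proof.
move=> Hu Hv; apply: almost_orthogonal => // c; rewrite subrr sqnorm_ge0 //.
exact: sH.2.
Qed.

Lemma sqnorm0_orth u v : H u -> H v -> sqn u = 0 -> dot v u = 0.
Proof.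
move=> Hu Hv u0; apply: sqmod_eq0.
by have := Cauchy_Schwarz Hv Hu; rewrite u0 mulr0.
Qed.

Lemma parallelogram u v : H u -> H v ->
  sqn (u - v) + sqn (u + v) = 2 * sqn u + 2 * sqn v.
Proof.
move=> Hu Hv; rewrite addrC -{1}[u]scale1r sqnorm_linear //.
rewrite addrC addrC [u - v]addrC -{1}[- v]scaleN1r sqnorm_linear //.
rewrite [dot v u](sip_conj hd) // /sqmod; case: (dot u v) => a b /=; lra.
Qed.

(** Gram-Schmidt: by induction, the last vector and [a] already have residuals
    [f'] and [a'] orthogonal to the first [n] vectors, and it remains to subtract
    from [a'] its component along [f']. *)
Lemma span_residual n (e : 'I_n -> V) : (forall i, H (e i)) ->
  forall a, H a -> exists alpha : 'I_n -> R[i],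
    forall i, dot (a - \sum_(j < n) alpha j *: e j) (e i) = 0.
Proof.
elim: n e => [|n IHn] e He; first by move=> a Ha; exists (fun=> 0) => -[].
pose e' (i : 'I_n) := e (widen_ord (leqnSn n) i).
have He' i : H (e' i) by exact: He.
pose f := e ord_max; have Hf : H f by exact: He.
have {IHn} IHn a (Ha : H a) := IHn e' He' a Ha.
have [beta fe'] := IHn f Hf; set f' := f - _ in fe'.
have Hf' : H f' by apply: subspaceB => //; exact: subspace_sum.
move=> a Ha; have [alpha ae'] := IHn a Ha; set a' := a - _ in ae'.
have Ha' : H a' by apply: subspaceB => //; exact: subspace_sum.
(* If [f'] has norm [0], then [c = 0], and [a'] is already orthogonal to [f']. *)
pose c := dot a' f' / dot f' f'.
have Hr : H (a' - c *: f') by apply: subspaceB => //; exact: subspaceZ.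
have re' i : dot (a' - c *: f') (e' i) = 0.
  by rewrite dotBl ?dotZl ?ae' ?fe' ?mulr0 ?subr0 //; exact: subspaceZ.
have rf' : dot (a' - c *: f') f' = 0.
  rewrite dotBl ?dotZl //; last exact: subspaceZ.
  have [f0|f0] := eqVneq (dot f' f') 0; last by rewrite divfK ?subrr.
  by rewrite f0 mulr0 subr0; apply: sqnorm0_orth => //; rewrite /sqnorm f0.
have rf : dot (a' - c *: f') f = 0.
  have -> : f = \sum_(j < n) beta j *: e' j + f' by rewrite addrC subrK.
  have Hs : H (\sum_(j < n) beta j *: e' j) by exact: subspace_sum.
  apply: orthC => //; first exact: subspaceD.
  rewrite dotDl // dot_sum // (orthC Hr Hf' rf') addr0 big1 // => i _.
  by rewrite (orthC Hr (He' i) (re' i)) mulr0.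
exists (fun i => if unlift ord_max i is Some j then alpha j - c * beta j else c).
have -> : \sum_(i < n.+1)
    (if unlift ord_max i is Some j then alpha j - c * beta j else c) *: e i =
    \sum_(j < n) alpha j *: e' j + c *: f'.
  rewrite big_ord_recr /= unlift_none -/f scalerBr scaler_sumr addrCA addrC.
  congr (_ + _); rewrite -sumrB; apply: eq_bigr => j _.
  have -> : widen_ord (leqnSn n) j = lift ord_max j.
    by apply: val_inj; rewrite /= /bump leqNgt ltn_ord.
  rewrite liftK scalerBl scalerA; congr (_ *: e _ - _ *: e _);
    by apply: val_inj; rewrite /= /bump leqNgt ltn_ord.
rewrite opprD addrA -/a' => i.
have [j ->|->] := unliftP ord_max i; last exact: rf.
have -> : e (lift ord_max j) = e' j; last exact: re'.
by congr e; apply: val_inj; rewrite /= /bump leqNgt ltn_ord.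
Qed.

(** Points [p n] of [M] that nearly attain the distance from [a] to [M] form a
    Cauchy sequence by the parallelogram law, because the midpoint of two of them
    is no closer to [a] than that distance. By [almost_orthogonal] the [a - p n]
    are orthogonal to [M] up to an error that vanishes in the limit. *)
Lemma orthogonal_projection (M : set V) :
  M `<=` H -> subspace M -> fast_complete H dot ->
  (forall u v, (forall n, M (u n)) -> H v ->
     sqn (u n - v) @[n --> \oo] --> 0 -> M v) ->
  forall a, H a -> exists2 p, M p & forall z, M z -> dot (a - p) z = 0.
Proof.
move=> MH sM cH clM a Ha.
pose E := [set sqn (a - m) | m in M].
have E0 : E !=set0 by exists (sqn (a - 0)), 0 => //; exact: sM.1.
have Ham m : M m -> H (a - m) by move=> /MH ?; exact: subspaceB.
have lbE : lbound E 0 by move=> _ [m /Ham Hm <-]; exact: sqnorm_ge0.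
pose D := inf E.
have Dle m : M m -> D <= sqn (a - m).
  by move=> Mm; apply: ge_inf; [exists 0 | exists m].
(* The division by [4] makes up for the factor in the parallelogram law. *)
pose eps n : R := 4^-1 ^+ n / 4.
have eps_gt0 n : 0 < eps n by rewrite divr_gt0 // exprn_gt0.
have {E0} near n : exists m, M m /\ sqn (a - m) < D + eps n.
  have [|_ [m Mm <-] mlt] := @inf_adherent R E (eps n) (eps_gt0 n).
    by split=> //; exists 0.
  by exists m.
have [p pP] := choice near; have Mp n := (pP n).1.
have p_cauchy n q : (n <= q)%N -> sqn (p q - p n) <= 4^-1 ^+ n.
  move=> nq; set mid := 2^-1 *: (p q + p n).
  have /Dle : M mid by apply: subspaceZ => //; exact: subspaceD.
  have Hq := Ham _ (Mp q); have Hn := Ham _ (Mp n).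
  have := parallelogram Hn Hq.
  have -> : a - p n - (a - p q) = p q - p n by rewrite opprB addrC addrA subrK.
  have -> : a - p n + (a - p q) = 2 *: (a - mid).
    rewrite scalerBr scalerA divff // scale1r scaler_nat mulr2n.
    by rewrite addrACA -opprD [p n + _]addrC.
  have -> : sqn (2 *: (a - mid)) = 4 * sqn (a - mid).
    rewrite sqnormZ; first by rewrite /sqmod /=; congr (_ * _); lra.
    by apply: Ham; apply: (subspaceZ sM); apply: (subspaceD sM).
  have := (pP n).2; have := (pP q).2.
  have : eps q <= eps n.
    rewrite /eps ler_pM2r // ler_wiXn2l //; lra.
  rewrite /eps; lra.
have [v Hv pv] := cH p (fun n => MH _ (Mp n)) p_cauchy.
have Mv := clM p v Mp Hv pv.
exists v => // z Mz; apply: sqmod_eq0; have Hz := MH _ Mz.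
have rate0 : 4^-1 ^+ n + sqn (p n - v) @[n --> \oo] --> 0.
  rewrite -[X in _ --> X]addr0; apply: cvgD pv.
  by have := cvg_geometric4 (1 : R); under eq_fun do rewrite mul1r.
apply: (le0_cvg (C := 2 * sqn z) rate0) => n.
have -> : a - v = (a - p n) + (p n - v) by rewrite addrA subrK.
have Hp := Ham _ (Mp n).
have Hpv : H (p n - v) by apply: subspaceB => //; exact: MH.
rewrite dotDl //; apply: le_trans (sqmodD_le _ _) _.
have := Cauchy_Schwarz Hpv Hz.
have : sqmod (dot (a - p n) z) <= eps n * sqn z.
  apply: almost_orthogonal => // c.
  have -> : c *: z + (a - p n) = a - ((- c) *: z + p n).
    by rewrite opprD scaleNr opprK addrCA.
  by have /Dle := sM.2 (- c) _ _ Mz (Mp n); have := (pP n).2; lra.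
have : 0 <= 4^-1 ^+ n * sqn z by rewrite mulr_ge0 // sqnorm_ge0.
by rewrite /eps; nra.
Qed.

End Theory.
End SemiInnerProduct.

(** * Completeness of the real L2 space *)

Section RealL2.
Context {d : measure_display} {T : measurableType d} {R : realType}.
Variable mu : {measure set T -> \bar R}.
Implicit Types f g : T -> R.

Lemma Lfun2_measurable f : f \in Lfun mu 2%:E -> measurable_fun setT f.
Proof. by move=> /sub_Lfun_mfun; rewrite inE. Qed.

Lemma Lfun2P f : measurable_fun setT f ->
  (\int[mu]_w (f w ^+ 2)%:E < +oo)%E -> f \in Lfun mu 2%:E.
Proof.
move=> mf fi; rewrite inE; apply/andP; split; rewrite inE //= /finite_norm.
rewrite unlock /Lnorm; apply: poweR_lty.
under eq_integral do rewrite /= powR_mulrn // real_normK ?num_real //.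
exact: fi.
Qed.

Lemma Lfun2_linear (c1 c2 : R) f g : f \in Lfun mu 2%:E -> g \in Lfun mu 2%:E ->
  (fun w => c1 * f w + c2 * g w) \in Lfun mu 2%:E.
Proof.
have le12 : (1 <= 2%:E :> \bar R)%E by rewrite lee_fin ler1n.
move=> hf hg; have [_ hZ] := Lfun_submod_closed mu le12.
have [h0 _] := Lfun_submod_closed mu le12.
have -> : (fun w => c1 * f w + c2 * g w) = c1 *: f + (c2 *: g + 0).
  by rewrite addr0; apply/funext => w.
by apply: (hZ) => //; exact: hZ.
Qed.

Lemma eq_Lfun2 f g : f \in Lfun mu 2%:E -> f =1 g -> g \in Lfun mu 2%:E.
Proof. by move=> hf /funext <-. Qed.

Lemma Lfun2_sub f g : f \in Lfun mu 2%:E -> g \in Lfun mu 2%:E ->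
  (fun w => f w - g w) \in Lfun mu 2%:E.
Proof.
move=> hf hg.
apply: (eq_Lfun2 (Lfun2_linear 1 (-1) hf hg)) => w.
by rewrite mul1r mulN1r.
Qed.

Lemma Lfun2_mul_integrable f g : f \in Lfun mu 2%:E -> g \in Lfun mu 2%:E ->
  mu.-integrable setT (EFin \o (fun w => f w * g w)).
Proof. by move=> hf hg; apply/Lfun1_integrable; exact: Lfun2_mul_Lfun1. Qed.

Lemma limn_einf_le (u : (\bar R)^nat) M : (forall n, (u n <= M)%E) ->
  (limn_einf u <= M)%E.
Proof.
move=> uM; rewrite limn_einf_lim; apply: lime_le; first exact: is_cvg_einfs.
apply: nearW => n; apply: le_trans (uM n); apply: ereal_inf_lbound.
by exists n => //=.
Qed.

Lemma sum_half_le (n : nat) : \sum_(0 <= i < n) 2^-1 ^+ i <= 2 :> R.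
Proof.
have -> : \sum_(0 <= i < n) 2^-1 ^+ i = 2 - 2 * 2^-1 ^+ n :> R.
  elim: n => [|n IHn]; first by rewrite big_geq // expr0; lra.
  by rewrite big_nat_recr //= IHn exprS; lra.
by have : 0 <= 2^-1 ^+ n :> R by []; lra.
Qed.

(** Weighting the squared increments by [2 ^+ i] trades square summability for
    absolute summability: the increment [y] satisfies
    [|y| <= 2^-1 ^+ i + 2 ^+ i * y ^+ 2]. *)
Lemma cvg_weighted_squares (x : R^nat) (M : R) :
  (forall n, \sum_(0 <= i < n) 2 ^+ i * (x i.+1 - x i) ^+ 2 <= M) -> cvgn x.
Proof.
move=> xM.
have step i : `|x i.+1 - x i| <= 2^-1 ^+ i + 2 ^+ i * (x i.+1 - x i) ^+ 2.
  have a0 : 0 < 2^-1 ^+ i :> R by [].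
  have -> : 2 ^+ i = (2^-1 ^+ i)^-1 :> R by rewrite exprVn invrK.
  rewrite -(real_normK (num_real _)); set a := 2^-1 ^+ i in a0 *.
  set y := `|_|; rewrite -(ler_pM2l a0) mulrDr mulrA divff ?gt_eqF // mul1r.
  by have := sqr_ge0 (y - a); have := sqr_ge0 y; nra.
have cv : cvgn (series (telescope x)).
  apply: normed_cvg; have -> : [normed series (telescope x)] =
      (fun n => \sum_(0 <= i < n) `|x i.+1 - x i|) by [].
  apply: nondecreasing_is_cvgn.
    move=> m n mn; rewrite [leRHS](big_cat_nat (leq0n m) mn) /= lerDl.
    exact: sumr_ge0.
  exists (2 + M) => _ [n _ <-]; apply: le_trans (lerD (sum_half_le n) (xM n)).
  by rewrite -big_split /=; apply: ler_sum => i _; exact: step.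
have -> : x = (fun n => x 0%N + series (telescope x) n).
  by apply/funext => n; exact: eq_sum_telescope.
by apply: is_cvgD => //; exact: is_cvg_cst.
Qed.

(** The weighted sum [g] of the squared increments has finite integral, hence is
    finite almost everywhere, and there [u n w] converges. Fatou's lemma applied
    to [(u (n + p) - u n) ^+ 2] as [p] grows bounds the distance from [u n] to
    the limit. *)
Lemma Lfun2_fast_complete (u : nat -> T -> R) :
  (forall n, u n \in Lfun mu 2%:E) ->
  (forall n p, (n <= p)%N ->
    (\int[mu]_w ((u p w - u n w) ^+ 2)%:E <= (4^-1 ^+ n)%:E)%E) ->
  exists2 v, v \in Lfun mu 2%:E &
    forall n, (\int[mu]_w ((u n w - v w) ^+ 2)%:E <= (4^-1 ^+ n)%:E)%E.
Proof.
move=> uL cauchy; have um n := Lfun2_measurable (uL n).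
have sqm f g : measurable_fun setT f -> measurable_fun setT g ->
    measurable_fun setT (fun w => ((f w - g w) ^+ 2)%:E).
  move=> mf mg; apply/measurable_EFinP; apply: measurable_funX.
  exact: measurable_funB.
pose h i w : \bar R := (2 ^+ i * (u i.+1 w - u i w) ^+ 2)%:E.
have h0 i w : (0 <= h i w)%E by rewrite lee_fin mulr_ge0 ?sqr_ge0.
have hm i : measurable_fun setT (h i).
  rewrite /h; under eq_fun do rewrite EFinM.
  by apply: emeasurable_funM; [exact: measurable_cst | exact: sqm].
have hi i : (\int[mu]_w h i w <= (2^-1 ^+ i)%:E)%E.
  rewrite /h; under eq_integral do rewrite EFinM.
  rewrite ge0_integralZl //; [|exact: sqm|by move=> *; rewrite lee_fin sqr_ge0].
  have -> : 2^-1 ^+ i = 2 ^+ i * 4^-1 ^+ i :> R.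
    by rewrite -exprMn; congr (_ ^+ _); lra.
  by rewrite EFinM lee_pmul2l // cauchy.
pose g w := (\sum_(0 <= i <oo) h i w)%E.
have gm : measurable_fun setT g.
  by apply: ge0_emeasurable_sum.
have g0 w : (0 <= g w)%E by exact: nneseries_ge0.
have gi : mu.-integrable setT g.
  apply/integrableP; split=> //.
  under eq_integral do rewrite gee0_abs //.
  rewrite integral_nneseries //; apply: (@le_lt_trans _ _ 2%:E); last exact: ltry.
  apply: lime_le; first by apply: is_cvg_nneseries => i _ _; exact: integral_ge0.
  apply: nearW => n; apply: (@le_trans _ _ (\sum_(0 <= i < n) (2^-1 ^+ i)%:E)%E).
    exact: lee_sum.
  by rewrite sumEFin lee_fin sum_half_le.
(* An upper limit is measurable whether or not the sequence converges. *)
pose v w := fine (limn_esup (fun n => (u n w)%:E)).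
have vm : measurable_fun setT v.
  apply: measurableT_comp => //; apply: measurable_fun_limn_esup => n.
  exact/measurable_EFinP.
have uv : {ae mu, forall w, u n w @[n --> \oo] --> v w}.
  have := integrable_ae measurableT gi; apply: filterS => w /(_ I) gfin.
  have /cvg_ex [l ul] : cvgn (u ^~ w).
    apply: (@cvg_weighted_squares _ (fine (g w))) => n.
    rewrite -lee_fin fineK // -sumEFin.
    by apply: (@nneseries_lim_ge _ (h ^~ w) xpredT 0%N) => i _ _; exact: h0.
  have : (u n w)%:E @[n --> \oo] --> l%:E by apply: cvg_EFin => //; exact: nearW.
  by move=> /cvg_limn_einf_sup[_]; rewrite /v => ->.
have bound n : (\int[mu]_w ((u n w - v w) ^+ 2)%:E <= (4^-1 ^+ n)%:E)%E.
  pose F p w := ((u (n + p)%N w - u n w) ^+ 2)%:E.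
  have Fm p : measurable_fun setT (F p) by exact: sqm.
  have F0 p w : setT w -> (0 <= F p w)%E by rewrite lee_fin sqr_ge0.
  have := fatou mu measurableT Fm F0.
  have -> : (\int[mu]_w limn_einf (F ^~ w) =
             \int[mu]_w ((u n w - v w) ^+ 2)%:E)%E.
    apply: ae_eq_integral => //; [|exact: sqm|].
      have -> : (fun w => limn_einf (F ^~ w)) =
          (fun w => - limn_esup (fun p => - F p w))%E.
        by apply/funext => w; rewrite -[limn_einf _]oppeK -limn_esupN.
      apply: measurableT_comp => //; apply: measurable_fun_limn_esup => p.
      exact: measurableT_comp.
    move: uv; apply: filterS => w uvw _.
    have : F p w @[p --> \oo] --> ((u n w - v w) ^+ 2)%:E.
      apply: cvg_EFin; first exact: nearW.
      have c : u (n + p)%N w - u n w @[p --> \oo] --> v w - u n w.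
        apply: cvgB; last exact: cvg_cst.
        by rewrite -(cvg_shiftn n) in uvw; under eq_fun do rewrite addnC.
      by rewrite -sqrrN opprB; exact: (cvgM c c).
    by move=> /cvg_limn_einf_sup[-> _].
  move=> /le_trans; apply; apply: limn_einf_le => p; apply: cauchy.
  exact: leq_addr.
exists v => //.
have -> : v = (fun w => u 0%N w - (u 0%N w - v w)).
  by apply/funext => w; rewrite subKr.
apply: Lfun2_sub => //; apply: Lfun2P.
  exact: measurable_funB.
by apply: le_lt_trans (bound 0%N) _; exact: ltry.
Qed.

End RealL2.

(** * The scalar product of the complex L2 space *)

Section ComplexL2.
Context {d : measure_display} {T : measurableType d} {R : realType}.
Variable mu : {measure set T -> \bar R}.
Implicit Types a b u v : T -> R[i].

Lemma L2_subspace : subspace (L2 mu).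
Proof.
have le12 : (1 <= 2%:E :> \bar R)%E by rewrite lee_fin ler1n.
have [h0 _] := Lfun_submod_closed mu le12; split=> // c u v [ur ui] [vr vi].
case: c => p q; split.
  apply: (eq_Lfun2 (Lfun2_linear 1 1 (Lfun2_linear p (- q) ur ui) vr)) => w /=.
  by rewrite !fctE; case: (u w) (v w) => [x y] [z t] /=; ring.
apply: (eq_Lfun2 (Lfun2_linear 1 1 (Lfun2_linear p q ui ur) vi)) => w /=.
by rewrite !fctE; case: (u w) (v w) => [x y] [z t] /=; ring.
Qed.

Lemma L2_conj a : L2 mu a -> L2 mu (fun w => conjc (a w)).
Proof.
move=> [ar ai]; split; first by apply: (eq_Lfun2 ar) => w; case: (a w).
apply: (eq_Lfun2 (Lfun2_linear (-1) 0 ai ai)) => w.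
by case: (a w) => x y /=; ring.
Qed.

Lemma Re_mul_conj_integrable a b : L2 mu a -> L2 mu b ->
  mu.-integrable setT (EFin \o (fun w => complex.Re (a w * conjc (b w)))).
Proof.
move=> [ar ai] [br bi].
have := integrableD measurableT (Lfun2_mul_integrable ar br)
  (Lfun2_mul_integrable ai bi).
congr (_.-integrable _ _); apply/funext => w /=.
by case: (a w) (b w) => [x y] [z t] /=; rewrite -EFinD; congr EFin; ring.
Qed.

Lemma Im_mul_conj_integrable a b : L2 mu a -> L2 mu b ->
  mu.-integrable setT (EFin \o (fun w => complex.Im (a w * conjc (b w)))).
Proof.
move=> [ar ai] [br bi].
have := integrableB measurableT (Lfun2_mul_integrable ai br)
  (Lfun2_mul_integrable ar bi).
congr (_.-integrable _ _); apply/funext => w /=.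
by case: (a w) (b w) => [x y] [z t] /=; rewrite -EFinB; congr EFin; ring.
Qed.

Lemma Rintegral_linear (p q : R) (f g h : T -> R) :
  mu.-integrable setT (EFin \o f) -> mu.-integrable setT (EFin \o g) ->
  mu.-integrable setT (EFin \o h) ->
  \int[mu]_w (p * f w + q * g w + h w) =
  p * (\int[mu]_w f w) + q * (\int[mu]_w g w) + \int[mu]_w h w.
Proof.
move=> fi gi hi.
have pf : mu.-integrable setT (EFin \o (fun w => p * f w)).
  by have := integrableZl measurableT p fi; congr (_.-integrable _ _).
have qg : mu.-integrable setT (EFin \o (fun w => q * g w)).
  by have := integrableZl measurableT q gi; congr (_.-integrable _ _).
rewrite RintegralD //; last first.
  by have := integrableD measurableT pf qg; congr (_.-integrable _ _).
by rewrite RintegralD // !RintegralZl.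
Qed.

Lemma sqnorm_L2E a : sqnorm (L2dot mu) a =
  \int[mu]_w (complex.Re (a w) ^+ 2 + complex.Im (a w) ^+ 2).
Proof.
rewrite /sqnorm /L2dot /cintegral /=; apply: eq_Rintegral => w _.
by case: (a w) => x y /=; ring.
Qed.

Lemma L2dot_semi_inner_product : semi_inner_product (L2 mu) (L2dot mu).
Proof.
split; first exact: L2_subspace.
- move=> [p q] u v w Lu Lv Lw.
  have ur := Re_mul_conj_integrable Lu Lw; have ui := Im_mul_conj_integrable Lu Lw.
  have vr := Re_mul_conj_integrable Lv Lw; have vi := Im_mul_conj_integrable Lv Lw.
  rewrite /L2dot /cintegral; apply/eqP; rewrite eq_complex /=; apply/andP; split.
    rewrite -mulNr -Rintegral_linear //; apply/eqP/eq_Rintegral => t _.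
    rewrite !fctE; case: (u t) (v t) (w t) => [x y] [z r] [k l] /=; ring.
  rewrite -Rintegral_linear //; apply/eqP/eq_Rintegral => t _.
  rewrite !fctE; case: (u t) (v t) (w t) => [x y] [z r] [k l] /=; ring.
- move=> u v Lu Lv; rewrite /L2dot /cintegral /=.
  congr (_ +i* _)%C.
    apply: eq_Rintegral => w _; case: (u w) (v w) => [x y] [z t] /=; ring.
  rewrite -mulN1r -RintegralZl //; last exact: Im_mul_conj_integrable.
  by apply: eq_Rintegral => w _; case: (u w) (v w) => [x y] [z t] /=; ring.
- move=> u Lu; have := sqnorm_L2E u; rewrite /sqnorm => ->.
  by apply: Rintegral_ge0 => w _; rewrite addr_ge0 ?sqr_ge0.
Qed.

Lemma L2normE a : L2norm mu a = Num.sqrt (sqnorm (L2dot mu) a).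
Proof.
rewrite sqnorm_L2E /L2norm unlock /Lnorm fine_poweR powR12_sqrt; last first.
  by rewrite fine_ge0 // integral_ge0 // => w _; rewrite lee_fin powR_ge0.
congr (Num.sqrt (fine _)); apply: eq_integral => w _ /=.
rewrite powR_mulrn // real_normK ?num_real //.
by case: (a w) => x y /=; rewrite sqr_sqrtr // addr_ge0 ?sqr_ge0.
Qed.

Lemma sqnorm_L2norm a : L2 mu a -> sqnorm (L2dot mu) a = L2norm mu a ^+ 2.
Proof.
by move=> La; rewrite L2normE sqr_sqrtr // (sqnorm_ge0 L2dot_semi_inner_product).
Qed.

Lemma sqnorm_integrable a : L2 mu a -> mu.-integrable setT
  (EFin \o (fun w => complex.Re (a w) ^+ 2 + complex.Im (a w) ^+ 2)).
Proof.
move=> La; have := Re_mul_conj_integrable La La.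
congr (_.-integrable _ _); apply/funext => w /=; congr EFin.
by case: (a w) => x y /=; ring.
Qed.

Lemma sqnorm_eq0_ae a : L2 mu a -> sqnorm (L2dot mu) a = 0 ->
  {ae mu, forall w, a w = 0}.
Proof.
move=> La; have ai := sqnorm_integrable La.
rewrite sqnorm_L2E => a0.
have /(ae_eq_integral_abs mu measurableT (measurable_int mu ai)) :
    (\int[mu]_w `|(complex.Re (a w) ^+ 2 + complex.Im (a w) ^+ 2)%:E| = 0)%E.
  under eq_integral do rewrite gee0_abs ?lee_fin ?addr_ge0 ?sqr_ge0 //.
  by rewrite -[LHS]fineK ?(integrable_fin_num measurableT ai) // [fine _]a0.
apply: filterS => w /(_ I) /= [aw0].
by apply: sqmod_eq0; rewrite /sqmod aw0.
Qed.

Lemma L2_fast_complete : fast_complete (L2 mu) (L2dot mu).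
Proof.
move=> u uL ucauchy.
have sub n p : L2 mu (u p - u n) by exact: (subspaceB L2_subspace).
have E2 a : L2 mu a -> (sqnorm (L2dot mu) a)%:E =
    (\int[mu]_w (complex.Re (a w) ^+ 2)%:E + \int[mu]_w (complex.Im (a w) ^+ 2)%:E)%E.
  move=> La; rewrite sqnorm_L2E /Rintegral fineK; last first.
    exact: (integrable_fin_num measurableT (sqnorm_integrable La)).
  have [/Lfun2_measurable mr /Lfun2_measurable mi] := La.
  under eq_integral do rewrite EFinD.
  rewrite ge0_integralD //.
  - by move=> w _; rewrite lee_fin sqr_ge0.
  - by apply/measurable_EFinP; exact: measurable_funX.
  - by move=> w _; rewrite lee_fin sqr_ge0.
  - by apply/measurable_EFinP; exact: measurable_funX.
have Ige0 (f : T -> R) : (0 <= \int[mu]_w (f w ^+ 2)%:E)%E.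
  by apply: integral_ge0 => w _; rewrite lee_fin sqr_ge0.
have ReB (x y : R[i]) : complex.Re (x - y) = complex.Re x - complex.Re y.
  by case: x y => [? ?] [? ?].
have ImB (x y : R[i]) : complex.Im (x - y) = complex.Im x - complex.Im y.
  by case: x y => [? ?] [? ?].
have [|n p np|vr vrL vrB] :=
    @Lfun2_fast_complete _ _ _ mu (fun n w => complex.Re (u n w)).
- by move=> n; have [] := uL n.
- have := ucauchy n p np; rewrite -lee_fin E2 //; apply: le_trans.
  under eq_integral do rewrite -ReB.
  by rewrite leeDl.
have [|n p np|vi viL viB] :=
    @Lfun2_fast_complete _ _ _ mu (fun n w => complex.Im (u n w)).
- by move=> n; have [] := uL n.
- have := ucauchy n p np; rewrite -lee_fin E2 //; apply: le_trans.
  under eq_integral do rewrite -ImB.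
  by rewrite leeDr.
pose v w := (vr w +i* vi w)%C; have Lv : L2 mu v by split.
exists v => //; have Luv n : L2 mu (u n - v) by exact: (subspaceB L2_subspace).
apply: (@squeeze_cvgr _ _ _ _ (fun=> 0) (fun n => 2 * 4^-1 ^+ n)).
- apply: nearW => n; rewrite (sqnorm_ge0 L2dot_semi_inner_product) //=.
  rewrite -lee_fin E2 // mulr_natl mulr2n EFinD leeD //.
    by have := vrB n; under eq_integral do rewrite -[vr _]/(complex.Re (v _)) -ReB.
  by have := viB n; under eq_integral do rewrite -[vi _]/(complex.Im (v _)) -ImB.
- exact: cvg_cst.
- exact: cvg_geometric4.
Qed.
End ComplexL2.

(** * The integral transform *)

Section Transform.
Context {d : measure_display} {T : measurableType d} {R : realType}.
Variables (mu : {measure set T -> \bar R}) (X : Type) (k : X -> T -> R[i]).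
Hypothesis k_L2 : forall y, L2 mu (k y).
Implicit Types a b : T -> R[i].

Local Notation S := (transform mu k).
Local Notation null := (null_space mu k).
Local Notation sqn := (sqnorm (L2dot mu)).
Local Notation hd := (L2dot_semi_inner_product mu).
Local Notation sL2 := (L2_subspace mu).

Let kbar y : T -> R[i] := fun w => (k y w)^*.

Let kbar_L2 y : L2 mu (kbar y). Proof. exact: L2_conj. Qed.

(** Turns every question about [S] into one about scalar products. *)
Lemma transformE a y : S a y = L2dot mu a (kbar y).
Proof.
rewrite /transform /L2dot; congr (cintegral mu _).
by apply/funext => w; rewrite /kbar conjCK.
Qed.

Lemma transform_sub a b : L2 mu a -> L2 mu b ->
  S (a - b) = (fun y => S a y - S b y).
Proof.
by move=> La Lb; apply/funext => y; rewrite !transformE (dotBl hd).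
Qed.

Lemma null_space_sub a b : L2 mu a -> L2 mu b -> S a = S b -> null (a - b).
Proof.
move=> La Lb ab; split; first exact: (subspaceB sL2).
by rewrite transform_sub // ab; apply/funext => y; rewrite subrr.
Qed.

Lemma null_space_subspace : subspace null.
Proof.
split.
  split; first exact: sL2.1.
  by apply/funext => y; rewrite transformE (dot0l hd).
move=> c u v [Lu u0] [Lv v0]; split; first exact: sL2.2.
apply/funext => y; rewrite transformE (sip_linear hd) // -!transformE u0 v0.
by rewrite mulr0 addr0.
Qed.

(** By the Cauchy-Schwarz inequality, [S] evaluated at a point is continuous. *)
Lemma null_space_closed (u : nat -> T -> R[i]) v : (forall n, null (u n)) ->
  L2 mu v -> sqn (u n - v) @[n --> \oo] --> 0 -> null v.
Proof.
move=> nu Lv uv; split=> //; apply/funext => y; apply: sqmod_eq0.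
apply: (le0_cvg (C := sqn (kbar y)) uv) => n; have [Lu u0] := nu n.
have Luv := subspaceB sL2 Lu Lv.
rewrite mulrC; apply: le_trans (Cauchy_Schwarz hd Luv (kbar_L2 y)).
rewrite (dotBl hd) // -!transformE u0 sub0r.
by case: (S v y) => p q; rewrite /sqmod /= !sqrrN.
Qed.

(** Subtracting from a preimage its projection on the null space leaves its
    image unchanged. *)
Lemma orth_preimage a : L2 mu a -> exists2 b, L2orth mu null b & S b = S a.
Proof.
move=> La.
have nL2 : null `<=` L2 mu by move=> b [].
have [p np porth] := orthogonal_projection hd nL2 null_space_subspace
  (@L2_fast_complete _ _ _ mu) null_space_closed La.
have [Lp p0] := np.
exists (a - p); first by split=> //; exact: (subspaceB sL2).
by rewrite transform_sub // p0; apply/funext => y; rewrite subr0.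
Qed.

Lemma L2norm_orth_le a b : L2 mu a -> L2 mu b -> L2dot mu (b - a) a = 0 ->
  L2norm mu a <= L2norm mu b.
Proof.
move=> La Lb ba; rewrite !L2normE ler_wsqrtr //.
have Lba : L2 mu (b - a) by exact: (subspaceB sL2).
have -> : b = (b - a) + a by rewrite subrK.
by rewrite (sqnormD_orth hd) // lerDr (sqnorm_ge0 hd).
Qed.

Lemma L2orth_null_ae a b : L2orth mu null a -> L2orth mu null b -> S a = S b ->
  {ae mu, forall w, a w = b w}.
Proof.
move=> [La oa] [Lb ob] ab; have nab := null_space_sub La Lb ab.
have : sqn (a - b) = 0 by rewrite /sqnorm (dotBl hd) ?oa ?ob ?subrr //; case: nab.
move=> /(sqnorm_eq0_ae nab.1); apply: filterS => w.
by rewrite !fctE => /eqP; rewrite subr_eq0 => /eqP.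
Qed.

Lemma L2norm_ge0 a : 0 <= L2norm mu a.
Proof. by rewrite L2normE sqrtr_ge0. Qed.

Lemma rkhs_norm_le a : L2 mu a -> rkhs_norm mu k (S a) <= L2norm mu a.
Proof.
move=> La; apply: ge_inf; last by exists a.
by exists 0 => _ [b _ <-]; exact: L2norm_ge0.
Qed.

Lemma le_rkhs_norm f c : rkhs mu k f ->
  (forall b, L2 mu b -> S b = f -> c <= L2norm mu b) -> c <= rkhs_norm mu k f.
Proof.
move=> [a La <-] cP; apply: lb_le_inf; first by exists (L2norm mu a), a.
by move=> _ [b [Lb ba] <-]; exact: cP.
Qed.

(** The residual [a - b] is orthogonal to the conjugates of the [k (x i)], which
    says both that [S a] and [S b] agree at the sample points and that [a - b] is
    orthogonal to [b]. Elements of the null space are orthogonal to these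
    functions too, hence to their combination [b]. *)
Lemma span_projection N (x : 'I_N -> X) a : L2 mu a -> exists b,
  [/\ representable mu k x b, L2orth mu null b,
      forall i, S b (x i) = S a (x i) & L2dot mu (a - b) b = 0].
Proof.
move=> La.
have [alpha aP] := span_residual hd (fun i => kbar_L2 (x i)) La.
set b := \sum_(j < N) _ in aP.
have Lb : L2 mu b by apply: (subspace_sum sL2) => i.
have orthb r : L2 mu r -> (forall i, L2dot mu r (kbar (x i)) = 0) ->
    L2dot mu r b = 0.
  move=> Lr r0; apply: (orthC hd) => //; rewrite (dot_sum hd) //.
  by rewrite big1 // => i _; rewrite (orthC hd Lr) ?mulr0.
have Lab : L2 mu (a - b) by exact: (subspaceB sL2).
exists b; split.
- by exists alpha; apply: aeW => w; rewrite /b fct_sumE.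
- split=> // z [Lz z0]; apply: (orthC hd) => //; apply: orthb => // i.
  by rewrite -transformE z0.
- move=> i; apply/eqP; rewrite -subr_eq0 -oppr_eq0 opprB !transformE.
  by rewrite -(dotBl hd) // aP.
- exact: orthb.
Qed.

End Transform.

Theorem proposition6p2 (R : realType) (d : measure_display)
  (T : measurableType d) (mu : {measure set T -> \bar R})
  (X : Type) (k : X -> T -> R[i])
  (k_L2 : forall y : X, L2 mu (k y))
  (N : nat) (x : 'I_N -> X)
  (lam : R -> R)
  (lam_nondecr : forall s t : R, 0 <= s -> s <= t -> lam s <= lam t)
  (L : 'rV[R[i]]_N -> \bar R)
  (L_gtNy : forall z, L z != -oo%E) :
  [/\ (exists a, minimiser (L2 mu) (Jbar mu k x L lam) a) ->
      exists a, minimiser (L2 mu) (Jbar mu k x L lam) a /\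
                representable mu k x a,
      (forall a, minimiser (L2 mu) (Jbar mu k x L lam) a ->
         minimiser (rkhs mu k) (J mu k x L lam) (transform mu k a)) /\
      (forall f, minimiser (rkhs mu k) (J mu k x L lam) f ->
         exists a,
           [/\ L2orth mu (null_space mu k) a,
               transform mu k a = f,
               (forall b, L2orth mu (null_space mu k) b ->
                  transform mu k b = f -> {ae mu, forall w, b w = a w}) &
               minimiser (L2 mu) (Jbar mu k x L lam) a])
    & (forall s t : R, 0 <= s -> s < t -> lam s < lam t) ->
      (exists2 b, L2 mu b & (Jbar mu k x L lam b < +oo)%E) ->
      forall a, minimiser (L2 mu) (Jbar mu k x L lam) a ->
        representable mu k x a /\ L2orth mu (null_space mu k) a].
Proof.
have row_eq (f g : X -> R[i]) : (forall i, f (x i) = g (x i)) ->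
    \row_i f (x i) = \row_i g (x i) by move=> fg; apply/rowP => i; rewrite !mxE.
(* An element orthogonal to the null space is a preimage of least norm. *)
have Jbar_le_J a : L2orth mu (null_space mu k) a ->
    (Jbar mu k x L lam a <= J mu k x L lam (transform mu k a))%E.
  move=> [La ao]; rewrite leeD2l // lee_fin lam_nondecr ?L2norm_ge0 //.
  apply: le_rkhs_norm => [|b Lb ba]; first by exists a.
  apply: L2norm_orth_le => //; apply: (orthC (L2dot_semi_inner_product mu)) => //.
    exact: (subspaceB (L2_subspace mu)).
  by apply: ao; exact: null_space_sub.
have J_le_Jbar a : L2 mu a ->
    (J mu k x L lam (transform mu k a) <= Jbar mu k x L lam a)%E.
  move=> La; rewrite leeD2l // lee_fin lam_nondecr ?rkhs_norm_le //.
  by apply: le_rkhs_norm => [|b _ _]; [exists a | exact: L2norm_ge0].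
have Jbar_span_le a b : L2 mu a -> L2 mu b ->
    (forall i, transform mu k b (x i) = transform mu k a (x i)) ->
    L2dot mu (a - b) b = 0 -> (Jbar mu k x L lam b <= Jbar mu k x L lam a)%E.
  move=> La Lb ba ortho; rewrite /Jbar (row_eq _ _ ba) leeD2l // lee_fin.
  by apply: lam_nondecr; [exact: L2norm_ge0 | exact: L2norm_orth_le].
split.
- move=> [a [La amin]].
  have [b [brep [Lb _] ba ortho]] := span_projection k_L2 x La.
  exists b; split=> //; split=> // u Lu; apply: le_trans (amin u Lu).
  exact: Jbar_span_le.
- split.
    move=> a [La amin]; split; first by exists a.
    move=> _ [c Lc <-]; apply: le_trans (J_le_Jbar _ La) _.
    have [b borth <-] := orth_preimage k_L2 Lc.
    by apply: le_trans (Jbar_le_J _ borth); apply: amin; case: borth.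
  move=> f [[c Lc <-{f}] fmin].
  have [a aorth ac] := orth_preimage k_L2 Lc.
  exists a; split=> //.
    by move=> b border bc; apply: (L2orth_null_ae k_L2) => //; rewrite ac.
  split=> [|u Lu]; first by case: aorth.
  apply: le_trans (Jbar_le_J _ aorth) _; rewrite ac.
  by apply: le_trans (J_le_Jbar _ Lu); apply: fmin; exists u.
- move=> lam_incr [c Lc cfin] a [La amin].
  have [b [brep [Lb bo] ba ortho]] := span_projection k_L2 x La.
  have Jab : (Jbar mu k x L lam a <= Jbar mu k x L lam b)%E by exact: amin.
  (* Only a finite loss can be cancelled from the inequality between values. *)
  have Lfin : L (\row_i transform mu k a (x i)) \is a fin_num.
    have : (Jbar mu k x L lam a < +oo)%E := le_lt_trans (amin c Lc) cfin.
    rewrite /Jbar; move: (L_gtNy (\row_i transform mu k a (x i))).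
    by case: (L _).
  move: Jab; rewrite /Jbar (row_eq _ _ ba) leeD2lE // lee_fin => lam_ab.
  have norm_ab : L2norm mu a = L2norm mu b.
    apply/eqP; rewrite eq_le (L2norm_orth_le Lb La ortho) andbT leNgt.
    apply/negP => ltba.
    by have := lam_incr _ _ (L2norm_ge0 mu b) ltba; rewrite ltNge lam_ab.
  have Lab : L2 mu (a - b) by exact: (subspaceB (L2_subspace mu)).
  have ab0 : sqnorm (L2dot mu) (a - b) = 0.
    have := sqnormD_orth (L2dot_semi_inner_product mu) Lab Lb ortho.
    by rewrite subrK !(sqnorm_L2norm La, sqnorm_L2norm Lb) norm_ab; lra.
  split; last first.
    split=> // z nz; have [Lz _] := nz; rewrite -(subrK b a).
    rewrite (dotDl (L2dot_semi_inner_product mu)) // bo // addr0.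
    apply: (orthC (L2dot_semi_inner_product mu)) => //.
    exact: (sqnorm0_orth (L2dot_semi_inner_product mu)).
  have [alpha balpha] := brep; exists alpha.
  move: balpha (sqnorm_eq0_ae Lab ab0); apply: filterS2 => w <-.
  by rewrite !fctE => /eqP; rewrite subr_eq0 => /eqP.
Qed.
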